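(* Let $L$ be a GO-space and let $X$ be a Lindelöf $\Sigma$-space. If there exists a continuous injection of $C_p(L,\{0,1\})$ into $C_p(X)$, then: (1) the Dedekind remainder $cL\setminus L$ does not contain a subspace homeomorphic to a stationary subset of an uncountable regular ordinal; and (2) $cL\setminus L$ is hereditarily paracompact.
   Context: A GO-space is a subspace of a linearly ordered topological space, considered with the induced linear order and the subspace topology. For spaces $X,Y$, $C_p(X,Y)$ is the set of all continuous maps $X\to Y$ with the topology of pointwise convergence (the subspace topology from the product $Y^X$); $C_p(X)=C_p(X,\mathbb{R})$; $\{0,1\}$ is discrete. A Lindelöf $\Sigma$-space is understood in the usual sense: a (Tychonoff) space that is a continuous image of a space admitting a perfect map onto a separable metrizable space. Dedekind completion $cL$ of a GO-space $L$: an ordered pair $\langle A,B\rangle$ of disjoint closed nonempty subsets of $L$ is a Dedekind section if $A\cup B=L$, $A$ is to the left of $B$ (every element of $A$ is less than every element of $B$), and $\max A$ does not exist or $\min B$ does not exist. The pair $\langle L,\emptyset\rangle$ (respectively $\langle\emptyset,L\rangle$) is also a Dedekind section if $\max L$ (respectively $\min L$) does not exist. The set $cL$ is the union of $L$ and the set of all Dedekind sections of $L$, ordered as follows: the order on $L$ is unchanged; if $x\in L$ and $y=\langle A,B\rangle\in cL\setminus L$, then $x<y$ if $x\in A$ and $x>y$ if $x\in B$; if $x=\langle A_1,B_1\rangle$ and $y=\langle A_2,B_2\rangle$ are in $cL\setminus L$, then $x<y$ if $A_1$ is a proper subset of $A_2$. $cL$ carries the topology of this linear order, and the Dedekind remainder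 $cL\setminus L$ has the subspace topology from $cL$. Ordinals carry the order topology and their subsets the subspace topology; an uncountable regular ordinal is an uncountable regular cardinal viewed as an ordinal; a subset of such a $\kappa$ is stationary if it meets every closed unbounded subset of $\kappa$. A space is hereditarily paracompact if each of its subspaces is paracompact. *)

(* Defs.v *)
From HB Require Import structures.
From mathcomp Require Import all_boot all_order all_algebra.
From mathcomp Require Import all_classical all_reals all_analysis.
From mathcomp Require wochoice.
Import Order.TTheory GRing.Theory Num.Theory.
Import numFieldNormedType.Exports.

Set Implicit Arguments.
Unset Strict Implicit.
Unset Printing Implicit Defensive.

Local Open Scope classical_set_scope.
Local Open Scope order_scope.

(** * General topology *)

Definition homeomorphic (T U : topologicalType) : Prop :=
  exists (f : T -> U) (g : U -> T),
    [/\ cancel f g, cancel g f, continuous f & continuous g].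

Definition separable (T : topologicalType) : Prop :=
  exists2 D : set T, countable D & dense D.

Definition metrizable (R : realType) (T : topologicalType) : Prop :=
  exists M : metricType R, homeomorphic T M.

Definition tychonoff_space (T : topologicalType) : Prop :=
  hausdorff_space T /\ completely_regular_space T.

(* Surjectivity is not included. *)
Definition perfect_map (T U : topologicalType) (f : T -> U) : Prop :=
  [/\ continuous f,
      forall C : set T, closed C -> closed (f @` C)
    & forall u : U, compact (f @^-1` [set u])].

(* All spaces are Tychonoff, as is customary in C_p-theory. *)
Definition lindelof_sigma (R : realType) (X : topologicalType) : Prop :=
  tychonoff_space X /\
  exists (Y M : topologicalType) (p : Y -> M) (q : Y -> X),
    [/\ tychonoff_space Y,
        separable M /\ metrizable R M,
        perfect_map p /\ range p = setT
      & continuous q /\ range q = setT].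

Definition open_cover (T : topologicalType) (U : set (set T)) : Prop :=
  U `<=` open /\ \bigcup_(u in U) u = setT.

Definition refines (T : Type) (V U : set (set T)) : Prop :=
  forall v, V v -> exists2 u, U u & v `<=` u.

Definition locally_finite (T : topologicalType) (V : set (set T)) : Prop :=
  forall x : T,
    exists2 W, nbhs x W & finite_set [set v | V v /\ v `&` W !=set0].

Definition paracompact (T : topologicalType) : Prop :=
  hausdorff_space T /\
  forall U : set (set T), open_cover U ->
    exists V : set (set T), [/\ open_cover V, refines V U & locally_finite V].

Definition hereditarily_paracompact (T : topologicalType) : Prop :=
  forall D : set T, paracompact (set_type D).

(* A subset of the product Y^X; coerced to a type, it carries the subspace
   topology. *)
Definition Cp (X Y : topologicalType) : set {ptws X -> Y} :=
  [set f | continuous (f : X -> Y)].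
Arguments Cp : clear implicits.

(** * GO-spaces *)

(* A GO-space is [set_type L] with [L : set K] and [K : orderTopologicalType d],
   under the subspace topology of the library and the induced order below. *)
HB.instance Definition _ (T : choiceType) (L : set T) :=
  SubChoice.copy (set_type L) {x : T | x \in L}.
HB.instance Definition _ d (K : orderType d) (L : set K) :=
  [SubChoice_isSubOrder of set_type L by <: with d].

(** * Dedekind completion *)

Section dedekind_sections.
Context {d : Order.disp_t} {K : orderTopologicalType d} (L : set K).
Implicit Types A B : set (set_type L).

Definition has_max A : Prop := exists2 m, A m & ubound A m.
Definition has_min A : Prop := exists2 m, A m & lbound A m.

Definition inner_section A B : Prop :=
  [/\ [/\ closed A, closed B, A !=set0 & B !=set0],
      A `&` B = set0, A `|` B = setT,
      forall a b, A a -> B b -> a < b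
    & ~ has_max A \/ ~ has_min B].

Definition dedekind_sections : set (set (set_type L) * set (set_type L)) := [set s |
  [\/ inner_section s.1 s.2,
      s = (setT, set0) /\ ~ has_max setT
    | s = (set0, setT) /\ ~ has_min setT]].

End dedekind_sections.
Arguments dedekind_sections {d K} L.

Definition dcompletion d (K : orderTopologicalType d) (L : set K) : Type :=
  (set_type L + set_type (dedekind_sections L))%type.

HB.instance Definition _ d (K : orderTopologicalType d) (L : set K) :=
  Choice.copy (dcompletion L) (set_type L + set_type (dedekind_sections L))%type.

Section dcompletion_order.
Context {d : Order.disp_t} {K : orderTopologicalType d} (L : set K).
Local Notation cL := (dcompletion L).
Implicit Types (x y z : cL) (s t : set_type (dedekind_sections L)).

Definition dcompletion_lt x y : bool :=
  match x, y with
  | inl a, inl b => a < b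
  | inl a, inr s => `[< (set_val s).1 a >]
  | inr s, inl b => `[< (set_val s).2 b >]
  | inr s, inr t => `[< (set_val s).1 `<` (set_val t).1 >]
  end.

Definition dcompletion_le x y : bool := (x == y) || dcompletion_lt x y.
Definition dcompletion_min x y : cL := if dcompletion_lt x y then x else y.
Definition dcompletion_max x y : cL := if dcompletion_lt x y then y else x.

Lemma sectionN s a : (set_val s).2 a <-> ~ (set_val s).1 a.
Proof.
case: (set_val s) (set_valP s : dedekind_sections L (set_val s)) => A B /=.
case=> /= [[_ AB0 ABT _ _]|[[-> ->] _]|[[-> ->] _]]; last 2 first.
- by split=> // /(_ I).
- by split=> // _ [].
split=> [Ba Aa|nAa]; first by have : set0 a by rewrite -AB0.
by have [|] : (A `|` B) a by rewrite ABT.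
Qed.

Lemma section_lt s a b : (set_val s).1 a -> (set_val s).2 b -> a < b.
Proof.
case: (set_val s) (set_valP s : dedekind_sections L (set_val s)) => A B /=.
by case=> /= [[_ _ _ + _]|[[-> ->] _]|[[-> ->] _]] //; exact.
Qed.

Lemma section_down s a b : b <= a -> (set_val s).1 a -> (set_val s).1 b.
Proof.
move=> ba Aa; apply: contrapT => /sectionN Bb.
by have := section_lt Aa Bb; rewrite ltNge ba.
Qed.

Lemma dcompletion_lt_irr : irreflexive dcompletion_lt.
Proof.
by case=> [a|s] /=; [exact: ltxx|apply/asboolP => -[]; exact].
Qed.

Lemma dcompletion_lt_trans : transitive dcompletion_lt.
Proof.
case=> [b|t] [a|s] [c|u] //=.
- exact: lt_trans.
- by move=> ab /asboolP ub; apply/asboolP/(section_down (ltW ab)).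
- move=> /asboolP sb bc; apply/asboolP/sectionN => /(section_down (ltW bc)).
  exact/sectionN.
- move=> /asboolP sb /asboolP ub; apply/asboolP; split.
    move=> a sa; apply: section_down ub; apply/ltW; exact: section_lt sa sb.
  by move=> /(_ _ ub); exact/sectionN.
- by move=> /asboolP ta /asboolP tc; exact: section_lt ta tc.
- by move=> /asboolP ta /asboolP[tu _]; apply/asboolP/tu.
- move=> /asboolP[st _] /asboolP tc; apply/asboolP/sectionN => /st.
  exact/sectionN.
- move=> /asboolP[st nts] /asboolP[tu nut]; apply/asboolP; split.
    exact: subset_trans tu.
  by move=> us; apply: nut; exact: subset_trans st.
Qed.

Lemma dcompletion_lt_total x y :
  x != y -> dcompletion_lt x y || dcompletion_lt y x.
Proof.
case: x y => [a|s] [b|t] /= xy.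
- by apply: lt_total; apply: contra_neq xy => ->.
- have [ta|nta] := pselect ((set_val t).1 a).
    by apply/orP; left; apply/asboolP.
  by apply/orP; right; apply/asboolP/sectionN.
- have [sb|nsb] := pselect ((set_val s).1 b).
    by apply/orP; right; apply/asboolP.
  by apply/orP; left; apply/asboolP/sectionN.
apply/orP; have [st|/existsNP[a /not_implyP[sa nta]]] :=
    pselect ((set_val s).1 `<=` (set_val t).1).
  left; apply/asboolP; split=> // ts; move/eqP: xy; apply; congr inr.
  apply: val_inj; have e1 : (set_val s).1 = (set_val t).1 by apply/seteqP.
  have e2 : (set_val s).2 = (set_val t).2.
    by apply/predeqP => a; rewrite !sectionN e1.
  by move: e1 e2; rewrite set_valE; case: (val s) (val t) => [? ?] [? ?] /= -> ->.
right; apply/asboolP; split=> [b tb|/(_ _ sa)//].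
apply: section_down sa; apply/ltW/(section_lt tb); exact/sectionN.
Qed.

End dcompletion_order.

Fact dcompletion_display : Order.disp_t. Proof. exact: Order.default_display. Qed.

HB.instance Definition _ d (K : orderTopologicalType d) (L : set K) :=
  Order.LtOrder.Build dcompletion_display (dcompletion L)
    (le := @dcompletion_le d K L) (lt := @dcompletion_lt d K L)
    (meet := @dcompletion_min d K L) (join := @dcompletion_max d K L)
    (fun _ _ => erefl) (fun _ _ => erefl) (fun _ _ => erefl)
    (@dcompletion_lt_irr d K L) (@dcompletion_lt_trans d K L)
    (@dcompletion_lt_total d K L).

HB.instance Definition _ d (K : orderTopologicalType d) (L : set K) :=
  OrderTopological.copy (dcompletion L) (order_topology (dcompletion L)).

Definition of_point d (K : orderTopologicalType d) (L : set K) : set_type L -> dcompletion L := inl.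

Definition dremainder d (K : orderTopologicalType d) (L : set K) : set (dcompletion L) :=
  ~` range (@of_point d K L).
Arguments dremainder {d K} L.

(** * Uncountable regular ordinals *)

Section ordinals.
Context {d : Order.disp_t} (K : orderTopologicalType d).
Implicit Types C S : set K.

Definition unbounded C : Prop := forall x, exists2 y, C y & x <= y.

(* Ordinals are represented by well-ordered types with the order topology. The
   third condition says that the ordinal is a cardinal (it is not equipotent to
   a smaller ordinal), the fourth that it equals its cofinality. *)
Definition uncountable_regular_ordinal : Prop :=
  [/\ wochoice.well_order (<=%O : rel K),
      ~ countable [set: K],
      forall x : K, ~ ([set: K] #<= [set y | y < x])%card
    & forall C, unbounded C -> ([set: K] #<= C)%card].

Definition club C : Prop := closed C /\ unbounded C.

Definition stationary S : Prop := forall C, club C -> C `&` S !=set0.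

End ordinals.

(* Main.v *)
Require Import Defs.
From mathcomp Require Import all_boot all_order all_algebra.
From mathcomp Require Import all_classical all_reals all_analysis.
From mathcomp Require Import lra.
Import Order.TTheory GRing.Theory Num.Theory.
Import numFieldNormedType.Exports.

(* The sections of [L] that form the remainder are cut off by clopen initial
   segments, whose characteristic functions embed the remainder in
   [Cp L {0,1}]; hence the remainder injects continuously into [Cp X], and
   after pulling back along the map [Y -> X], [Y] maps perfectly onto a
   separable metrizable space.

   A stationary set [S] does not inject continuously into such a [Cp Y].  Let
   [f s], for [s] in [S], be the images; each [f s y] is eventually constant
   in [s], say equal to [g y].  Close off under the choice, for every finite
   set of indices and every finite precision, of points of [Y] realizing all
   the approximate values that are realized.  If [s] in [S] is closed, then
   every [x] has a companion [z] with [f t z = f t x] for [t < s] and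
   [f s z = g x], so [f s x = f s z = g x] by continuity at [s].  Thus
   [f s = g] for more than one [s].

   For the second part, as in the Engelking-Lutzer theorem, points of a
   GO-space are identified when the interval between them has a locally finite
   open refinement of the cover.  The classes are clopen, and each half of a
   class is refined along a cofinal set [C] of regular order type: if [C] is
   uncountable, the set of limits of [C] that converge is not stationary, so
   a club of limits cuts the half class into bounded clopen blocks. *)

Set Implicit Arguments.
Unset Strict Implicit.
Unset Printing Implicit Defensive.

Local Open Scope classical_set_scope.

(** * Stationary sets in regular well-orders *)

Section regular_orders.
Local Open Scope order_scope.
Context {d : Order.disp_t} {K : orderType d}.
Implicit Types (S N : set K) (x y a b s t : K).

(** The first clause excludes a least element, for which the second is vacuous. *)
Definition limit_of N x := (exists a, a < x) /\
  forall a, a < x -> exists2 b, N b & a < b < x.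

Definition cofinal_set N := forall x, exists2 y, N y & x <= y.

(** Clubs are expressed through the order alone, so that the notion applies to a well-ordered subset
    of an order without topology. *)
Definition stationary_set S := forall N, limit_of N `<=` N -> cofinal_set N ->
  N `&` S !=set0.

Definition wf_order := forall A : set K, A !=set0 -> exists2 m, A m & lbound A m.

Definition regular_order := [/\ wf_order,
  forall (h : K -> K) x, exists b, forall y, y < x -> h y < b
  & forall h : nat -> K, exists b, forall n, h n < b].

(** The bound [a] makes the condition vacuous at a least element of [K], where no [c < s] exists. *)
Definition left_continuous_on (T : topologicalType) S (phi : K -> T) :=
  forall s, S s -> forall W, nbhs (phi s) W -> forall a, a < s ->
  exists2 c, c < s & forall t, S t -> c < t -> t <= s -> W (phi t).

Lemma left_continuous_on_comp (T U : topologicalType) S (phi : K -> T)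
    (f : T -> U) :
  continuous f -> left_continuous_on S phi -> left_continuous_on S (f \o phi).
Proof. by move=> fc lc s Ss W fW; apply: (lc s Ss (f @^-1` W)); exact: fc. Qed.

Hypothesis Kreg : regular_order.

Lemma regular_order_gt x : exists y, x < y.
Proof. by have [_ _ /(_ (fun=> x))[y /(_ 0%N)]] := Kreg; exists y. Qed.

Lemma regular_order_seq_bounded (h : seq K -> K) x :
  exists b, forall ts, all (< x) ts -> h ts < b.
Proof.
have [_ hreg hom] := Kreg.
suff H j (g : seq K -> K) :
    exists b, forall ts, size ts = j -> all (< x) ts -> g ts < b.
  have /choice[B HB] := fun j => H j h.
  have [b hb] := hom B; exists b => ts tsx.
  exact: lt_trans (HB _ _ erefl tsx) (hb _).
elim: j g => [|j IH] g.
  have [b hb] := hom (fun=> g [::]); exists b => ts /size0nil -> _.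
  exact: hb 0%N.
have /choice[B HB] := fun t => IH (fun ts => g (t :: ts)).
have [b hb] := hreg B x; exists b => -[|t ts]//= [sz] /andP[tx tsx].
exact: lt_trans (HB _ _ sz tsx) (hb _ tx).
Qed.

Lemma stationary_set_neq0 S : stationary_set S -> S !=set0.
Proof.
move=> /(_ setT)[]// => [x|x [_ Sx]]; [by exists x|by exists x].
Qed.

(** The points closed under all [h m] contain their limits, because a finite list below a limit is
    already below some closed point. They are cofinal: iterate a bound for the values countably
    often and take the supremum. *)
Lemma stationary_set_closing S (h : nat -> seq K -> K) : stationary_set S ->
  exists2 s, S s & forall m ts, all (< s) ts -> h m ts < s.
Proof.
move=> Sst; have [wf _ hom] := Kreg.
pose N s := forall m ts, all (< s) ts -> h m ts < s.
suff [s [Ns Ss]] : N `&` S !=set0 by exists s.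
apply: Sst => [s [[a as_] Ns] m ts tss|x].
  suff [b Nb /andP[tsb bs]] : exists2 b, N b & (all (< b) ts) && (b < s).
    exact: lt_trans (Nb _ _ tsb) bs.
  elim: ts tss => [_|t ts IH /= /andP[ts_ /IH[b Nb /andP[tsb bs]]]].
    by have [b Nb /andP[_ bs]] := Ns _ as_; exists b.
  have [tb|bt] := ltP t b; first by exists b; rewrite ?tb ?tsb.
  have [c Nc /andP[tc cs]] := Ns _ ts_; exists c => //; rewrite tc cs andbT /=.
  by apply/allP => u /(allP tsb)/lt_trans; apply; exact: le_lt_trans tc.
have step y : exists z, y < z /\ forall m ts, all (< y) ts -> h m ts < z.
  have /choice[B HB] := fun m => regular_order_seq_bounded (h m) y.
  have [b hb] := hom B; have [c yc] := regular_order_gt y.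
  exists (Order.max b c); split=> [|m ts tsy]; first by rewrite lt_max yc orbT.
  by rewrite lt_max (lt_trans (HB _ _ tsy) (hb m)).
have {step}[B HB] := choice step.
pose u n := iter n B x.
have [s us smin] : exists2 s, (forall n, u n < s) &
    forall r, (forall n, u n < r) -> s <= r.
  have [|s us smin] := wf [set r | forall n, u n < r]; last by exists s.
  by have [b ub] := hom u; exists b.
have lts t : t < s -> exists n, t < u n.
  move=> ts; apply: contrapT => /forallNP nt; move: ts.
  rewrite ltNge => /negP; apply; apply: smin => n.
  apply: lt_le_trans (_ : u n.+1 <= t); first by case: (HB (u n)).
  by rewrite leNgt; apply/negP/nt.
have umono : {homo u : m n / (m <= n)%N >-> m <= n}.
  by apply: homo_leq => [//|? ? ?|n]; [exact: le_trans|exact/ltW/(HB _).1].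
exists s; last exact/ltW/(us 0%N).
move=> m ts tss; suff [n tsn] : exists n, all (< u n) ts.
  exact: lt_trans ((HB _).2 _ _ tsn) (us n.+1).
elim: ts tss => [_|t ts IH /= /andP[/lts[n tn] /IH[k tsk]]]; first by exists 0%N.
exists (maxn n k); rewrite (lt_le_trans tn) ?umono ?leq_maxl//=.
by apply/allP => v /(allP tsk) /lt_le_trans; apply; rewrite umono ?leq_maxr.
Qed.

Lemma stationary_set_gt S x : stationary_set S -> exists2 s, S s & x < s.
Proof.
by move=> /(stationary_set_closing (fun _ _ => x))[s Ss /(_ 0%N [::] isT)]; exists s.
Qed.

(** If values [<= p] and values [>= q], with [p < q], both occurred cofinally, a point of [S] closed
    under choosing them would violate left continuity. The countably many rational pairs then share
    one bound. *)
Lemma stationary_set_eventually_const (R : realType) S (phi : K -> R) :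
  stationary_set S -> left_continuous_on S phi ->
  exists a, forall s t, S s -> S t -> a < s -> a < t -> phi s = phi t.
Proof.
move=> Sst lc; have [_ _ hom] := Kreg.
have H (p q : R) : p < q -> exists a, forall s t, S s -> S t -> a < s -> a < t ->
    ~ (phi s <= p /\ q <= phi t).
  move=> pq; apply: contrapT => /forallNP nb.
  have /choice[a1 ha1] : forall a, exists v, [/\ S v, a < v & phi v <= p].
    move=> a; apply: contrapT => /forallNP na.
    by apply: (nb a) => s t Ss _ as_ _ [sp _]; apply: (na s).
  have /choice[a2 ha2] : forall a, exists v, [/\ S v, a < v & q <= phi v].
    move=> a; apply: contrapT => /forallNP na.
    by apply: (nb a) => s t _ St _ at_ [_ qt]; apply: (na t).
  have [s0 _] := stationary_set_neq0 Sst.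
  (* The empty list returns [s0], which forces [s0 < s] as left continuity demands; index 0 selects
     small values, every other index large ones. *)
  pose h (m : nat) ts :=
    if ts is t :: _ then (if m is 0%N then a1 t else a2 t) else s0.
  have [s Ss sh] := stationary_set_closing h Sst.
  have e0 : (0 < (q - p) / 2)%R by lra.
  have [c cs hc] := lc s Ss _ (nbhsx_ballx _ _ e0) s0 (sh 0%N [::] isT).
  have c1s : a1 c < s by have /= := sh 0%N [:: c]; rewrite andbT; exact.
  have c2s : a2 c < s by have /= := sh 1%N [:: c]; rewrite andbT; exact.
  have [Sa1 ca1 pa1] := ha1 c; have [Sa2 ca2 pa2] := ha2 c.
  have := hc _ Sa1 ca1 (ltW c1s); have := hc _ Sa2 ca2 (ltW c2s).
  by rewrite /ball/= /ball_ !ltr_norml => /andP[? ?] /andP[? ?]; lra.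
have /choice[u hu] : forall m, exists a, forall p q : rat, unpickle m = Some (p, q) ->
    p < q -> forall s t, S s -> S t -> a < s -> a < t ->
    ~ (phi s <= ratr p /\ ratr q <= phi t).
  move=> m; case E : (unpickle m : option (rat * rat)%type) => [[p q]|]; last first.
    by have [s0 _] := stationary_set_neq0 Sst; exists s0.
  have [pq|pq] := ltP p q; last first.
    have [s0 _] := stationary_set_neq0 Sst; exists s0 => p' q' [<- <-].
    by rewrite ltNge pq.
  have [|a ha] := H (ratr p) (ratr q); first by rewrite ltr_rat.
  by exists a => ? ? [<- <-].
have [a ha] := hom u; exists a.
suff lt_absurd s t : S s -> S t -> a < s -> a < t -> ~ phi s < phi t.
  move=> s t Ss St as_ at_; apply/eqP; rewrite eq_le !leNgt.
  by apply/andP; split; apply/negP; exact: lt_absurd.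
move=> Ss St as_ at_ st.
have [p] := rat_in_itvoo st; rewrite in_itv/= => /andP[sp pt].
have [q] := rat_in_itvoo pt; rewrite in_itv/= => /andP[pq qt].
have := hu (pickle (p, q)) p q (pickleK _); rewrite -(ltr_rat R).
move=> /(_ pq s t Ss St (lt_trans (ha _) as_) (lt_trans (ha _) at_)); apply.
by split; exact: ltW.
Qed.

End regular_orders.
Arguments regular_order {d} K.
Arguments wf_order {d} K.

(** * Stationary sets do not inject into function spaces *)

Section sigma_spaces.
Context {R : realType}.
Local Open Scope ring_scope.

(* [N] is a countable network modulo the compact cover formed by the [C x]. *)
Definition sigma_network (Y : topologicalType) (N : nat -> set Y)
    (C : Y -> set Y) :=
  forall x, compact (C x) /\
  forall U, open U -> C x `<=` U -> exists2 n, N n x & N n `<=` U.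

Lemma floor_mul_eq_dist (x y : R) k :
  Num.floor (x * k.+1%:R) = Num.floor (y * k.+1%:R) -> `|x - y| < k.+1%:R^-1.
Proof.
move=> e; have k0 : (0 < k.+1%:R :> R)%R by rewrite ltr0n.
rewrite -[ltRHS]div1r ltr_pdivlMr// -[X in _ * X](ger0_norm (ltW k0)) -normrM.
rewrite mulrBl ltr_norml.
have /andP[] := floor_itv (x * k.+1%:R); have /andP[] := floor_itv (y * k.+1%:R).
by rewrite e intrD => *; apply/andP; split; lra.
Qed.

(** The compact sets are the fibres of [p], the network the preimages of small balls centred in the
    dense set. As [p] is closed, an open [U] around a fibre contains the preimage of an open set
    around its image. *)
Lemma perfect_sigma_network (Y M : topologicalType) (p : Y -> M) :
  separable M -> metrizable R M -> perfect_map p ->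
  exists (N : nat -> set Y) C, sigma_network N C.
Proof.
case=> D /countable_injP[c cinj] Dd [M0 [f [g [fK gK fc gc]]]] [pc pcl pk].
exists (fun m => [set y | exists e k, [/\ D e, unpickle m = Some (c e, k) &
  ball (f e) (k.+1%:R^-1) (f (p y))]]).
exists (fun y => p @^-1` [set p y]) => x; split=> // U Uo pxU.
have Vo : open (~` (p @` (~` U))) by apply/closed_openC/pcl/open_closedC.
have Vx : (~` (p @` (~` U))) (g (f (p x))).
  by rewrite fK => -[y nUy pyx]; apply: nUy; exact: pxU.
have [e /= e0 eV] : exists2 e : R, 0 < e & ball (f (p x)) e `<=` g @^-1` (~` (p @` (~` U))).
  by apply/nbhs_ballP; apply: gc; exact: open_nbhs_nbhs.
have /ltr_add_invr[k] : 0 < e / 2 by rewrite divr_gt0.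
rewrite add0r => ke.
have k0 : 0 < k.+1%:R^-1 :> R by rewrite invr_gt0.
pose O := f @^-1` (ball (f (p x)) k.+1%:R^-1)^°.
have Oo : open O by apply: open_comp => [? _|]; [exact: fc|exact: open_interior].
have Ox : O (p x) by exact: nbhsx_ballx.
have [m [+ Dm]] := Dd O (ex_intro _ _ Ox) Oo.
move=> /interior_subset/ball_sym mx.
exists (pickle (c m, k)); first by exists m, k; rewrite pickleK.
move=> y [m' [k' [Dm' ]]]; rewrite pickleK => -[/cinj + <-] m'y.
rewrite !inE => /(_ Dm Dm') mm'; rewrite -mm' in m'y.
apply: contrapT => nUy.
have := eV (f (p y)); rewrite /= fK; apply.
  have /(ball_triangle (ball_sym mx)) := m'y; apply: le_ball.
  by rewrite [leRHS]splitr lerD ?ltW.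
by exists y.
Qed.

Local Open Scope order_scope.

(** [G] encodes a continuous injection of [T] into the function space of [Y]. Keeping [T] abstract
    serves both the remainder and its subspaces. *)
Lemma stationary_sigma_not_injective (Y T : topologicalType)
    (N : nat -> set Y) (C : Y -> set Y) (G : T -> Y -> R)
    (d : Order.disp_t) (K : orderType d) (S : set K) (phi : K -> T) :
  sigma_network N C ->
  injective G -> (forall t, continuous (G t)) ->
  (forall y, continuous (G ^~ y)) ->
  regular_order K -> stationary_set S -> left_continuous_on S phi ->
  ~ {in S &, injective phi}.
Proof.
move=> NC Ginj Gc1 Gc2 Kreg Sst phic phiinj.
pose f s := G (phi s).
have fc s : continuous (f s) by exact: Gc1.
have fl y : left_continuous_on S (f ^~ y).
  exact: (left_continuous_on_comp (Gc2 y) phic).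
have /choice[al hal] : forall y, exists a, forall s t,
    S s -> S t -> a < s -> a < t -> f s y = f t y.
  by move=> y; exact: stationary_set_eventually_const.
have /choice[om hom] : forall y, exists s, S s /\ al y < s.
  by move=> y; have [s] := stationary_set_gt Kreg (al y) Sst; exists s.
pose g y := f (om y) y.
have gE y s : S s -> al y < s -> f s y = g y.
  by move=> Ss ys; apply: hal => //; case: (hom y).
(* The approximate values are rounded to a list of integers, so that the triples [(n, k, c)] below
   can be coded by natural numbers. *)
pose sig k ts y := Num.floor (g y * k.+1%:R)%R ::
  [seq Num.floor (f t y * k.+1%:R)%R | t <- ts].
have [s0 _] := stationary_set_neq0 Sst.
have /choice[h hh] : forall mts : nat * seq K, exists b, forall n k c,
    unpickle mts.1 = Some (n, k, c) ->
    (exists2 y, N n y & sig k mts.2 y = c) ->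
    exists y, [/\ N n y, sig k mts.2 y = c & al y <= b].
  case=> m ts /=.
  case E : (unpickle m : option (nat * nat * seq int)%type) => [[[n k] c]|];
    last by exists s0.
  have [[y Ny yc]|ny] := pselect (exists2 y, N n y & sig k ts y = c).
    by exists (al y) => ? ? ? [<- <- <-] _; exists y.
  by exists s0 => ? ? ? [<- <- <-].
have /choice[nx hnx] : forall x, exists s, S s /\ x < s.
  by move=> x; have [s] := stationary_set_gt Kreg x Sst; exists s.
(* By [sh], every [x] is approximated by points [y] with [al y < s], where
   [f s y = g y]; compactness of [C x] turns them into a [z] in [C x] with
   [f s z = g x] and [f t z = f t x] for all [t < s], and left continuity at
   [s] gives [f s x = f s z]. *)
have key s : S s -> (forall m ts, all (< s) ts -> h (m, ts) < s) ->
    (forall t, t < s -> nx t < s) -> f s = g.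
  move=> Ss sh snx; apply/funext => x.
  have s0s : h (0%N, [::]) < s by exact: (sh 0%N [::]).
  have [Cx NCx] := NC x.
  (* [v] holds the values demanded of [z]; [P (ts, k)] is the open set of points that miss one of
     those with index in [ts] by more than [1 / (k + 1)]. *)
  pose v t := if t == s then g x else f t x.
  pose P (i : seq K * nat) (z : Y) := exists2 t : K, t \in i.1 &
    [/\ S t, t <= s & i.2.+1%:R^-1 < `|f t z - v t| ].
  have Popen i : open (P i).
    suff -> : P i = \bigcup_(t in [set t : K | [/\ t \in i.1, S t & t <= s]])
        (fun z => `|f t z - v t|) @^-1` `]i.2.+1%:R^-1, +oo[.
      apply: bigcup_open => t _; move: (i.2.+1%:R^-1 : R) => e.
      apply: open_comp => [z _|]; last exact: rray_open.
      by apply: cvg_norm; apply: cvgB; [exact: fc|exact: cvg_cst].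
    apply/seteqP; split=> z.
      by case=> t ti [St ts tz]; exists t => //=; rewrite in_itv/= tz.
    by case=> t [ti St ts] /=; rewrite in_itv/= andbT => tz; exists t.
  have [z [Cz zs zlt]] : exists z, [/\ C x z, f s z = g x &
      forall t, S t -> t < s -> f t z = f t x].
    (* If no [z] exists, compactness along the filter of growing finite index sets and precisions
       puts all of [C x] into a single [P (ts, k)]. *)
    apply: contrapT => noz.
    pose F : set_system (seq K * nat) := filter_from setT
      (fun i : seq K * nat => [set j | {subset i.1 <= j.1} /\ (i.2 <= j.2)%N]).
    have FF : Filter F.
      apply: filter_from_filter; first by exists ([::], 0%N).
      move=> i j _ _; exists (i.1 ++ j.1, maxn i.2 j.2) => //= l [/= ijl].
      rewrite geq_max => /andP[il jl].
      by split; split=> // t ti; apply: ijl; rewrite mem_cat ti ?orbT.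
    have /compact_near_coveringP/(_ _ F P FF) := Cx.
    case=> [z Cz|[ts k] _ /(_ (ts, k))].
      have [t [St ts tz]] : exists t, [/\ S t, t <= s & f t z != v t].
        apply: contrapT => /forallNP nt; apply: noz; exists z; split=> //.
          apply/eqP; apply: contrapT => /negP ne; apply: (nt s).
          by split=> //; rewrite /v eqxx.
        move=> t St ts; apply/eqP; apply: contrapT => /negP ne; apply: (nt t).
        by split; [exact: St|exact: ltW|rewrite /v (lt_eqF ts)].
      have := tz; rewrite -subr_eq0 -normr_gt0 => /ltr_add_invr[k].
      rewrite add0r => hk.
      exists (P ([:: t], k), [set j : seq K * nat | t \in j.1 /\ (k <= j.2)%N]).
        split=> /=; first by apply: open_nbhs_nbhs; split=> //; exists t; rewrite ?inE.
        by exists ([:: t], k) => //= j [/(_ t)]; rewrite inE eqxx; split=> //; auto.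
      case=> z' j /= [[t' /[!inE]/eqP-> [_ _ htz]] [tj kj]]; exists t => //.
      by split=> //; apply: le_lt_trans htz; rewrite lef_pV2 ?posrE// ler_nat.
    move=> /(_ (conj (fun _ => id) (leqnn _))) /(NCx _ (Popen _))[n Nx NP].
    pose ts' := [seq t <- ts | t < s].
    (* This [y] in [N n] has the signature of [x], and [al y < s] yields [f s y = g y]; hence it
       cannot lie in [P (ts, k)]. *)
    have [||y [Ny ysig yh]] := hh (pickle (n, k, sig k ts' x), ts') n k (sig k ts' x).
    + exact: pickleK.
    + by exists x.
    have ys : al y < s.
      by apply: le_lt_trans yh (sh _ _ _); apply/allP => t; rewrite mem_filter => /andP[].
    have [t tts [St ts_]] := NP _ Ny; apply/negP; rewrite -leNgt /=.
    case: ysig => gxy fxy; rewrite ltW// /v; case: eqP => [->|/eqP nts].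
      by rewrite gE//; exact: floor_mul_eq_dist.
    apply: floor_mul_eq_dist; move/eq_in_map: fxy; apply.
    by rewrite mem_filter lt_neqAle nts ts_.
  rewrite -zs; apply/esym/eqP; apply: contrapT => /negP ne.
  have e0 : 0 < `|f s z - f s x| by rewrite normr_gt0 subr_eq0.
  (* The difference vanishes at all [t < s] in [S], hence also at [s]. *)
  have fzx : left_continuous_on S (fun t => f t z - f t x).
    apply: (left_continuous_on_comp (f := fun t => G t z - G t x) _ phic).
    by move=> t; apply: continuousB; [exact: Gc2|exact: Gc2].
  have [c cs hc] := fzx s Ss _ (nbhsx_ballx _ _ e0) _ s0s.
  have [Snx cnx] := hnx c; have nxs := snx _ cs.
  have := hc _ Snx cnx (ltW nxs).
  by rewrite /ball/= /ball_/= (zlt (nx c))// subrr subr0 ltxx.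
(* Three closing conditions are merged: positive indices give [h], index 0 gives [nx] on nonempty
   lists and the lower bound [b] on the empty one. *)
pose h' b m ts := if ts is t :: _ then (if m is m'.+1 then h (m', ts) else nx t)
  else if m is m'.+1 then h (m', ts) else b.
have close b : exists s, [/\ S s, b < s & f s = g].
  have [s Ss hs] := stationary_set_closing Kreg (h' b) Sst.
  exists s; split=> //; first exact: (hs 0%N [::]).
  apply: key => // [m ts tss|t ts]; last first.
    by apply: (hs 0%N [:: t]); rewrite /= ts.
  by have := hs m.+1 ts tss; case: ts {tss}.
have [s [Ss _ fs]] := close s0; have [t [St st ft]] := close s.
have : phi s = phi t by apply: Ginj; rewrite -/(f s) fs.
by move=> /phiinj; rewrite !inE => /(_ Ss St) e; rewrite e ltxx in st.
Qed.

End sigma_spaces.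

(** * Regular ordinals with the order topology *)

Section ordinals.
Local Open Scope order_scope.
Local Open Scope classical_set_scope.

Lemma nbhs_set_type (T : topologicalType) (A : set T) (x : set_type A)
    (W : set (set_type A)) :
  nbhs x W -> exists2 V, nbhs (set_val x) V & set_val @^-1` V `<=` W.
Proof.
case=> U [[V oV <-] Vx sub]; exists V => //; exact: open_nbhs_nbhs.
Qed.

Context {d : Order.disp_t} {K : orderTopologicalType d}.
Implicit Types (x a b c t : K) (S W : set K).

Lemma order_nbhs_left x W : nbhs x W -> forall a, a < x ->
  exists2 c, c < x & forall t, c < t -> t <= x -> W t.
Proof.
rewrite itv_nbhsE => -[[l r] [/= oe xlr] lrW] a ax.
have [c cx lc] : exists2 c, c < x & forall t, c < t -> (l <= BLeft t)%O.
  case: l oe xlr {lrW} => [[] l|[]] //=; last by exists a.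
  rewrite itv_boundlr => _ /andP[]; rewrite bnd_simp => lx _.
  by exists l => // t lt_; rewrite bnd_simp.
exists c => // t ct tx; apply: lrW => /=; rewrite itv_boundlr lc//=.
by move: xlr; rewrite itv_boundlr => /andP[_]; apply: le_trans; rewrite bnd_simp.
Qed.

(** An unbounded image of a proper initial segment, or of the natural numbers, would be as large as
    [K]. *)
Lemma uncountable_regular_ordinal_regular :
  uncountable_regular_ordinal K -> regular_order K.
Proof.
case=> wo nc nlt reg; split.
- move=> A [a Aa]; have [|m [[mA mlb] _]] := wo [pred x | `[< A x >]].
    by exists a; exact/asboolP.
  exists m; first exact/asboolP.
  by move=> b Ab; apply: mlb; exact/asboolP.
- move=> h x; apply: contrapT => /forallNP nb; apply: (nlt x).
  apply: card_le_trans (card_image_le h _); apply: reg => b.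
  have /existsNP[y /not_implyP[yx /negP]] := nb b.
  by rewrite -leNgt => bhy; exists (h y) => //; exists y.
- move=> h; apply: contrapT => /forallNP nb; apply: nc.
  have : countable (range h) by apply: card_le_trans (card_image_le h _) _; exact: countableP.
  apply: card_le_trans; apply: reg => b.
  have /existsNP[n /negP] := nb b.
  by rewrite -leNgt => bhn; exists (h n).
Qed.

(** A cofinal set that contains its limits is topologically closed. *)
Lemma stationary_stationary_set S : regular_order K -> stationary S ->
  stationary_set S.
Proof.
move=> Kreg Sst N Nlim Ncof; apply: Sst; split; last exact: Ncof.
move=> x Nx; apply: contrapT => nNx.
(* The open ray below the successor [y] of [x] contains nothing above [x], so points of [N] near [x]
   approach it from below. *)
have [y xy ymin] : exists2 y, x < y & forall z, x < z -> y <= z.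
  have [wf _ _] := Kreg; have [z xz] := regular_order_gt Kreg x.
  by have [|y xy ymin] := wf [set y | x < y]; [exists z|exists y].
have lex z : z < y -> z <= x by move=> zy; rewrite leNgt; apply/negP => /ymin; rewrite leNgt zy.
suff H V : open V -> V x -> exists2 b, N b & V b /\ b < x.
  apply: nNx; apply: Nlim; split.
    by have [b _ [_ bx]] := H _ openT I; exists b.
  move=> a ax; have [||b Nb [ab bx]] := H `]a, +oo[%classic; first exact: rray_open.
    by rewrite /= in_itv/= ax.
  by exists b => //; move: ab; rewrite /= in_itv/= andbT bx => ->.
move=> oV Vx; have [|b [Nb []]] := Nx (V `&` `]-oo, y[).
  apply: open_nbhs_nbhs; split; first by apply: openI; last exact: lray_open.
  by split=> //=; rewrite in_itv.
rewrite /= in_itv/= => Vb /lex bx; exists b => //; split=> //.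
by rewrite lt_neqAle bx andbT; apply/eqP => e; rewrite e in Nb.
Qed.

End ordinals.

Lemma stationary_not_embeddable (R : realType) (T Y : topologicalType)
    (N : nat -> set Y) (C : Y -> set Y) (G : T -> Y -> R)
    (d : Order.disp_t) (K : orderTopologicalType d) (S : set K) (D : set T) :
  sigma_network N C -> injective G -> (forall t, continuous (G t)) ->
  (forall y, continuous (G ^~ y)) ->
  uncountable_regular_ordinal K -> stationary S ->
  ~ homeomorphic (set_type D) (set_type S).
Proof.
move=> NC Ginj Gc1 Gc2 Kord Sstat [f [g [_ gK _ gc]]].
have Kreg := uncountable_regular_ordinal_regular Kord.
have Sst := stationary_stationary_set Kreg Sstat.
have [s0 Ss0] := stationary_set_neq0 Sst.
pose g' s Ss : T := set_val (g (exist _ s (mem_set Ss))).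
pose phi s := if pselect (S s) is left Ss then g' s Ss else g' s0 Ss0.
have phiE s (Ss : S s) : phi s = g' s Ss.
  rewrite /phi; case: pselect => // Ss'; congr g'; exact: Prop_irrelevance.
have phic : left_continuous_on S phi.
  move=> s Ss W; rewrite (phiE _ Ss) => Wn a as_.
  have gvc : continuous (set_val \o g).
    by move=> u; apply: continuous_comp; [exact: gc|exact: initial_continuous].
  have [V Vs VW] := nbhs_set_type (gvc _ _ Wn).
  have [c cs hc] := order_nbhs_left Vs as_; exists c => // t St ct ts.
  by rewrite (phiE _ St); apply: (VW (exist _ t (mem_set St))); exact: hc.
apply: (stationary_sigma_not_injective NC Ginj Gc1 Gc2 Kreg Sst phic).
move=> s t /[!inE] Ss St; rewrite (phiE _ Ss) (phiE _ St).
by move=> /val_inj/(can_inj gK)[].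
Qed.

(** * The Dedekind remainder as a function space *)

Section dremainder_function_space.
Local Open Scope order_scope.
Context {d : Order.disp_t} {M : orderTopologicalType d} (L : set M).
Local Notation rem := (set_type (dremainder L)).
Implicit Types r : rem.

Lemma dremainder_inr r : exists s, \val r = inr s.
Proof.
by case: r => -[a|s] /= h; [move/set_mem: h => []; exists a|exists s].
Qed.

Lemma section_closed (s : set_type (dedekind_sections L)) :
  closed (set_val s).1 /\ closed (set_val s).2.
Proof.
case: (set_valP s : dedekind_sections L (set_val s)) => [[[]]//|[-> _]|[-> _]].
  by split; [exact: closedT|exact: closed0].
by split; [exact: closed0|exact: closedT].
Qed.

Definition lower_char r : set_type L -> bool := fun a => of_point a < \val r.

Lemma lower_char_Cp r : Cp (set_type L) bool (lower_char r).
Proof.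
have [s rs] := dremainder_inr r; have [c1 c2] := section_closed s.
have charE a : lower_char r a = `[< (set_val s).1 a >] by rewrite /lower_char rs.
suff loc a : \forall b \near a, lower_char r b = lower_char r a.
  move=> a W /= /nbhs_singleton Wa; apply: filterS (loc a) => b /= e.
  by rewrite e.
have [sa|sa] := pselect ((set_val s).1 a).
  have : nbhs a (~` (set_val s).2).
    apply: open_nbhs_nbhs; split; first exact: closed_openC.
    by move=> /sectionN.
  apply: filterS => b; rewrite !charE => /= nb.
  by rewrite !asboolT//; apply: contrapT => /sectionN.
have : nbhs a (~` (set_val s).1) by apply: open_nbhs_nbhs; split=> //; exact: closed_openC.
by apply: filterS => b; rewrite !charE => /= nb; rewrite !asboolF.
Qed.

Definition lower_Cp r : set_type (Cp (set_type L) bool) :=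
  exist _ (lower_char r : {ptws set_type L -> bool}) (mem_set (@lower_char_Cp r)).

Lemma lower_Cp_inj : injective lower_Cp.
Proof.
move=> r r' [/(congr1 (fun f => f _))e].
have {}e a : lower_char r a = lower_char r' a by exact: e.
apply: val_inj; have [s rs] := dremainder_inr r.
have [s' rs'] := dremainder_inr r'.
have {}e a : (set_val s).1 a <-> (set_val s').1 a.
  have := e a; rewrite /lower_char rs rs'.
  rewrite -[LHS]/(`[< (set_val s).1 a >]) -[RHS]/(`[< (set_val s').1 a >]) => ea.
  by split=> /asboolP h; apply/asboolP; move: h; rewrite ea.
apply/eqP; rewrite eq_le !leNgt rs rs'; apply/andP; split; apply/negP.
  by move=> /asboolP[_]; apply => a /e.
by move=> /asboolP[_]; apply => a /e.
Qed.

(** A point of the remainder is never a point of [L], so one of the two open rays cut off by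
    [of_point a] is a neighbourhood of [r] on which the value at [a] is constant. *)
Lemma continuous_lower_Cp : continuous lower_Cp.
Proof.
apply: (@continuous_comp_initial _ _ _ set_val) => r.
have FF : Filter (((set_val : _ -> {ptws set_type L -> bool}) \o lower_Cp) @ r).
  exact: (@fmap_filter _ _ _ _ (nbhs_filter r)).
apply/(pointwise_cvgP _ FF) => a W /= /nbhs_singleton Wa.
suff : nbhs r [set r' | lower_char r' a = lower_char r a].
  by apply: filterS => r' /= e; suff : W (lower_char r' a) by []; rewrite e.
have vc : continuous (\val : rem -> dcompletion L) by exact: initial_continuous.
have [ar|ra] := boolP (lower_char r a).
  suff : nbhs r (\val @^-1` `]of_point a, +oo[).
    by apply: filterS => r' /=; rewrite in_itv/= andbT.
  apply: open_nbhs_nbhs; split; last by rewrite /= in_itv/= andbT.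
  by apply: open_comp => [? _|]; [exact: vc|exact: rray_open].
have neq r' : of_point a != \val r'.
  by have [s ->] := dremainder_inr r'.
suff : nbhs r (\val @^-1` `]-oo, of_point a[).
  apply: filterS => r' /=; rewrite in_itv/= => h; apply/negbTE.
  by rewrite -leNgt ltW.
apply: open_nbhs_nbhs; split.
  by apply: open_comp => [? _|]; [exact: vc|exact: lray_open].
by rewrite /= in_itv/= lt_neqAle eq_sym neq leNgt.
Qed.

(** Composition with [q] replaces [X] by [Y], whose perfect map supplies the network; injectivity
    survives because [q] is onto. *)
Lemma dremainder_separate_family (R : realType) (X : topologicalType) :
  lindelof_sigma R X ->
  (exists F : set_type (Cp (set_type L) bool) -> set_type (Cp X R),
      continuous F /\ injective F) ->
  exists (Y : topologicalType) (N : nat -> set Y) (C : Y -> set Y)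
    (G : rem -> Y -> R),
  [/\ sigma_network N C, injective G, forall r, continuous (G r)
    & forall y, continuous (G ^~ y)].
Proof.
case=> _ [Y [Z [p [q [_ [sZ mZ] [pp _] [qc qT]]]]]] [F [Fc Finj]].
have [N [C NC]] := perfect_sigma_network sZ mZ pp.
exists Y, N, C, (fun r y => (\val (F (lower_Cp r)) : X -> R) (q y)); split=> //.
- move=> r r' e; apply/lower_Cp_inj/Finj/val_inj/funext => x.
  have : range q x by rewrite qT.
  by case=> y _ <-; exact: (congr1 (fun f => f y) e).
- move=> r y; apply: continuous_comp; first exact: qc.
  exact: (set_valP (F (lower_Cp r)) : Cp _ _ _).
- move=> y r.
  apply: (@continuous_comp _ _ _ (F \o lower_Cp) (fun f => (\val f : X -> R) (q y))).
    by apply: continuous_comp; [exact: continuous_lower_Cp|exact: Fc].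
  have vc : continuous (set_val : set_type (Cp X R) -> {ptws X -> R}).
    exact: initial_continuous.
  exact: (cvg_comp _ _ (vc _) (@proj_continuous X (fun=> R) (q y) _)).
Qed.

End dremainder_function_space.

(** * Paracompactness of GO-spaces *)

Section cofinality.
Local Open Scope order_scope.
Local Open Scope classical_set_scope.
Context {d : Order.disp_t} {E : orderType d}.
Implicit Types (A B C I : set E) (a b c x y : E).

(** [J] consists of the records of [h] along [r]. The [r]-least index whose value reaches [a] is a
    record, and [h] is increasing on records, so their image inherits well-foundedness. *)
Lemma well_order_thinning (r : rel E) A I (h : E -> E) :
  antisymmetric r ->
  (forall B, B `<=` I -> B !=set0 -> exists2 m, B m & forall b, B b -> r m b) ->
  (forall a, A a -> exists2 y, I y & a <= h y) ->
  exists J, [/\ J `<=` I, forall a, A a -> exists2 y, J y & a <= h y,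
    forall y z, J y -> J z -> r y z -> y != z -> h y < h z
  & forall B, B `<=` h @` J -> B !=set0 -> exists2 m, B m & lbound B m].
Proof.
move=> ranti rwf hcof.
pose J := [set y | I y /\ forall z, I z -> r z y -> z != y -> h z < h y].
have Jlt y z : J y -> J z -> r y z -> y != z -> h y < h z.
  by move=> [Iy _] [_ +] ryz yz; exact.
exists J; split=> //.
- by move=> y [].
- move=> a /hcof[y0 Iy0 ay0].
  have [|y [Iy ay] ymin] := rwf [set y | I y /\ a <= h y] (fun y => @proj1 _ _).
    by exists y0.
  exists y => //; split=> // z Iz rzy zy; apply: lt_le_trans ay.
  rewrite ltNge; apply/negP => az; move/eqP: zy; apply.
  by apply: ranti; rewrite rzy ymin.
- move=> B BJ [b Bb]; have [y Jy hyb] := BJ _ Bb.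
  have [||y0 [Jy0 By0] ymin] := rwf [set y | J y /\ B (h y)].
    + by move=> z [[]].
    + by exists y; rewrite /= hyb.
  exists (h y0) => // c Bc; have [z Jz hzc] := BJ _ Bc; rewrite -hzc.
  have [->//|ne] := eqVneq y0 z; apply/ltW/Jlt => //.
  by apply: ymin; rewrite /= hzc.
Qed.

Lemma regular_cofinal_set A : A !=set0 -> exists C, [/\ C `<=` A,
  forall a, A a -> exists2 c, C c & a <= c,
  forall B, B `<=` C -> B !=set0 -> exists2 m, B m & lbound B m
& forall x (h : E -> E), C x -> (forall y, C y -> y < x -> A (h y)) ->
    exists2 b, A b & forall y, C y -> y < x -> h y < b].
Proof.
move=> [a0 Aa0].
(* The records of the identity along an arbitrary well-ordering of [E] form a cofinal set
   well-ordered by [<=]. *)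
have [C0 [C0A C0cof C0wf]] : exists C, [/\ C `<=` A,
    forall a, A a -> exists2 c, C c & a <= c
  & forall B, B `<=` C -> B !=set0 -> exists2 m, B m & lbound B m].
  have [r rwo] := wochoice.well_ordering_principle E.
  have rwo' B : B !=set0 -> exists2 m, B m & forall b, B b -> r m b.
    move=> [b Bb]; have [|m [[mB mlb] _]] := rwo [pred x | `[< B x >]].
      by exists b; exact/asboolP.
    exists m; first exact/asboolP.
    by move=> c Bc; apply: mlb; exact/asboolP.
  have ranti : antisymmetric r.
    have W : wochoice.wo_chain r predT by move=> B _; exact: rwo.
    by move=> x y; exact: (wochoice.wo_chain_antisymmetric W).
  have [||C [CA Ccof _ Cwf]] := @well_order_thinning r A A id ranti.
  - by move=> B _; exact: rwo'.
  - by move=> a Aa; exists a.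
  - by exists C; split=> // B BC; apply: Cwf; rewrite image_id.
(* If a map [h] from the points of [C0] below [x] is cofinal in [A], with [x]
   least, then the records of [h] form a cofinal set of smaller order type, and
   minimality of [x] makes it regular. *)
pose bad x := C0 x /\ exists h : E -> E, (forall y, C0 y -> y < x -> A (h y)) /\
  forall a, A a -> exists2 y, C0 y /\ y < x & a <= h y.
have nbad C x (h : E -> E) :
    ~ (forall a, A a -> exists2 y, C y /\ y < x & a <= h y) ->
    exists2 b, A b & forall y, C y -> y < x -> h y < b.
  move=> /existsNP[b /not_implyP[Ab nb]]; exists b => // y Cy yx.
  by rewrite ltNge; apply/negP => bhy; apply: nb; exists y.
have [[x0 badx0]|/forallNP nb] := pselect (exists x, bad x); last first.
  exists C0; split=> // x h C0x hA; apply: nbad => hcof.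
  by apply: (nb x); split=> //; exists h.
have [|x [C0x [h [hA hcof]]] xmin] := C0wf bad _ (ex_intro _ _ badx0).
  by move=> x [].
have [||J [JI Jcof Jlt Jwf]] :=
    @well_order_thinning <=%O A [set y | C0 y /\ y < x] h le_anti.
- by move=> B BI B0; have [|m] := C0wf B _ B0; [move=> y /BI[]|exists m].
- by move=> a /hcof[y Cy ahy]; exists y.
exists (h @` J); split=> //.
- by move=> _ [y /JI[C0y yx] <-]; exact: hA.
- by move=> a /Jcof[y Jy ay]; exists (h y) => //; exists y.
move=> _ k [t Jt <-] kA; apply: nbad => kcof.
have [C0t tx] := JI _ Jt.
have : x <= t; last by rewrite leNgt tx.
(* A map [k] cofinal from below [h t] makes [t] bad through the composite [k (h y)]; off [J] the
   point [a0] of [A] fills in. *)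
apply: xmin; split=> //; exists (fun y => if pselect (J y) then k (h y) else a0).
split=> [y C0y yt|a /kcof[_ [[y Jy <-] hyt] akhy]].
  by case: pselect => // Jy; apply: kA; [exists y|apply: Jlt; rewrite ?ltW// lt_eqF].
exists y; last by case: pselect.
split; first by case: (JI _ Jy).
rewrite ltNge; apply/negP => ty; move: hyt; rewrite ltNge => /negP; apply.
by have [->//|ne] := eqVneq t y; apply/ltW/Jlt.
Qed.

Lemma regular_cofinal A : A !=set0 ->
  (forall h : nat -> E, (forall n, A (h n)) -> exists2 b, A b & forall n, h n < b) ->
  exists C, [/\ C `<=` A, forall a, A a -> exists2 c, C c & a <= c
    & regular_order (set_type C)].
Proof.
move=> A0 Aom; have [a0 Aa0] := A0.
have [C [CA Ccof Cwf Creg]] := regular_cofinal_set A0.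
have CV (u : set_type C) : C (\val u) by exact: set_valP.
exists C; split=> //; split.
- move=> B [b Bb]; have [||_ [m Bm <-] mlb] := Cwf (\val @` B).
  + by move=> _ [u _ <-].
  + by exists (\val b), b.
  by exists m => // c Bc; rewrite -Order.le_val; apply: mlb; exists c.
- move=> h x.
  pose h' y := if pselect (C y) is left Cy then \val (h (exist _ y (mem_set Cy))) else a0.
  have [|b Ab hb] := Creg (\val x) h' (CV x).
    by move=> y Cy _; rewrite /h'; case: pselect => // Cy'; exact/CA/CV.
  have [c Cc bc] := Ccof _ Ab; exists (exist _ c (mem_set Cc)) => y.
  rewrite -!lt_val => yx; apply: lt_le_trans bc.
  have := hb _ (CV y) yx; rewrite /h'; case: pselect => // Cy.
  by congr (\val (h _) < _); exact: val_inj.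
- move=> h; have [|b Ab hb] := Aom (fun n => \val (h n)).
    by move=> n; exact/CA/CV.
  have [c Cc bc] := Ccof _ Ab; exists (exist _ c (mem_set Cc)) => n.
  by rewrite -lt_val; exact: lt_le_trans bc.
Qed.

End cofinality.

(** * Combining locally finite refinements *)

Section locally_finite_refinements.
Context {T : topologicalType} (U : set (set T)).
Implicit Types A B : set T.

(** Only [A] has to be covered, but local finiteness is required at every point of [T], so that
    refinements for different sets can be united. *)
Definition has_lf_refinement A := exists V : set (set T),
  [/\ V `<=` open, refines V U, A `<=` \bigcup_(v in V) v & locally_finite V].

Lemma has_lf_refinementS A B :
  A `<=` B -> has_lf_refinement B -> has_lf_refinement A.
Proof.
by move=> AB [V [Vo VU BV Vlf]]; exists V; split=> //; exact: subset_trans BV.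
Qed.

Lemma has_lf_refinementU A B : has_lf_refinement A -> has_lf_refinement B ->
  has_lf_refinement (A `|` B).
Proof.
move=> [V [Vo VU AV Vlf]] [W [Wo WU BW Wlf]]; exists (V `|` W); split.
- by move=> v [/Vo|/Wo].
- by move=> v [/VU|/WU].
- by move=> x [/AV[v]|/BW[v]] ? ?; exists v => //; [left|right].
- move=> x; have [A1 xA1 fA1] := Vlf x; have [A2 xA2 fA2] := Wlf x.
  exists (A1 `&` A2); first exact: filterI.
  apply: sub_finite_set (_ : finite_set ([set v | V v /\ v `&` A1 !=set0] `|`
    [set v | W v /\ v `&` A2 !=set0])); last by rewrite finite_setU.
  by move=> v [[Vv|Wv] [y [vy [A1y A2y]]]]; [left|right]; split=> //; exists y.
Qed.

Lemma has_lf_refinement1 A u : U u -> open u -> A `<=` u -> has_lf_refinement A.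
Proof.
move=> Uu uo Au; exists [set u]; split.
- by move=> _ ->.
- by move=> _ ->; exists u.
- by move=> x /Au ux; exists u.
- move=> x; exists setT; first exact: filterT.
  by apply: sub_finite_set (finite_set1 u) => v [].
Qed.

(** The refinement chosen for [i] is cut down to [J i]; near a given point only finitely many of
    these then matter. *)
Lemma has_lf_refinement_bigcup (I : choiceType) (D : set I) (J : I -> set T) A :
  (forall i, D i -> open (J i)) ->
  (forall x : T, exists2 W, nbhs x W & finite_set [set i | D i /\ J i `&` W !=set0]) ->
  (forall i, D i -> has_lf_refinement (J i `&` A)) ->
  A `<=` \bigcup_(i in D) J i -> has_lf_refinement A.
Proof.
move=> Jo Jlf Jr AJ.
have /choice[V HV] : forall i, exists V : set (set T), D i ->
    [/\ V `<=` open, refines V U, J i `&` A `<=` \bigcup_(v in V) v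
      & locally_finite V].
  move=> i; have [Di|nDi] := pselect (D i); last by exists set0.
  by have [V] := Jr i Di; exists V.
exists (\bigcup_(i in D) [set J i `&` v | v in V i]); split.
- move=> _ [i Di [v Vv <-]]; have [Vo _ _ _] := HV _ Di.
  by apply: openI; [exact: Jo|exact: Vo].
- move=> _ [i Di [v Vv <-]]; have [_ VU _ _] := HV _ Di.
  by have [u Uu vu] := VU _ Vv; exists u => // x [_ /vu].
- move=> x Ax; have [i Di Jx] := AJ _ Ax; have [_ _ cov _] := HV _ Di.
  have [v Vv vx] := cov _ (conj Jx Ax).
  by exists (J i `&` v) => //; exists i => //; exists v.
- move=> x; have [W0 xW0 fin0] := Jlf x.
  have /choice[W HW] : forall i, exists W : set T, nbhs x W /\ (D i ->
      finite_set [set v | V i v /\ v `&` W !=set0]).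
    move=> i; have [Di|nDi] := pselect (D i); last first.
      by exists setT; split=> //; exact: filterT.
    by have [_ _ _ /(_ x)[W xW fW]] := HV _ Di; exists W.
  set F := [set i | _] in fin0.
  exists (W0 `&` \bigcap_(i in F) W i).
    apply: filterI => //.
    have /finite_fsetP[F' ->] := fin0; apply: filter_bigI => i _.
    by case: (HW i).
  apply: sub_finite_set (_ : finite_set (\bigcup_(i in F)
    [set J i `&` v | v in [set v | V i v /\ v `&` W i !=set0]])).
    move=> _ [[i Di [v Vv <-]] [y [[Jy vy] [W0y Wy]]]].
    have Fi : F i by split=> //; exists y.
    by exists i => //; exists v => //; split=> //; exists y; split=> //; exact: Wy.
  apply: bigcup_finite => // i [Di _]; apply: finite_image.
  by case: (HW i) => _; exact.
Qed.

End locally_finite_refinements.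

(** * GO-spaces and their initial sets *)

Section go_spaces.
Local Open Scope order_scope.
Local Open Scope classical_set_scope.

(** This is the intrinsic description of GO-topologies by open rays and convex neighbourhoods. With
    the order in a separate type, subspaces and the reversed order need no new topology. *)
Definition go_embedding (T : topologicalType) d (E : orderType d) (e : T -> E) :=
  [/\ forall a, open [set y | e y < a] /\ open [set y | a < e y]
    & forall (x : T) W, nbhs x W -> exists V, [/\ nbhs x V, V `<=` W
        & forall a b c, V a -> V b -> e a <= e c -> e c <= e b -> V c]].

(** Excluding left-continuous injections demands more than excluding homeomorphic copies; it fits
    the map [phi] built from initial sets below. *)
Definition no_stationary_copy (T : topologicalType) :=
  forall d (K : orderType d) (S : set K) (phi : K -> T),
  regular_order K -> stationary_set S -> left_continuous_on S phi ->
  ~ {in S &, injective phi}.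

Section initial_sets.
Context {T : topologicalType} {d : Order.disp_t} {E : orderType d} {e : T -> E}.
Hypothesis ego : go_embedding e.
Context (C : set E).
Local Notation K := (set_type C).
Implicit Types (c l m : K) (N : set K).

(** The bound by some [c < l] leaves out points that are below [l] but above every such [c]. *)
Definition initial_set l := [set y | exists2 c, c < l & e y <= \val c].

Lemma initial_set_le l m : l <= m -> initial_set l `<=` initial_set m.
Proof. by move=> lm y [c cl yc]; exists c => //; exact: lt_le_trans lm. Qed.

Lemma initial_set_open l : limit_of setT l -> open (initial_set l).
Proof.
move=> [_ lim]; have [eopen _] := ego.
suff -> : initial_set l = \bigcup_(c in [set c | c < l]) [set y | e y < \val c].
  by apply: bigcup_open => c _; case: (eopen (\val c)).
apply/seteqP; split=> y.
  move=> [c cl yc]; have [b _ /andP[cb bl]] := lim _ cl.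
  by exists b => //=; apply: le_lt_trans yc _; rewrite lt_val.
by move=> [c cl /= yc]; exists c => //; exact: ltW.
Qed.

Lemma closure_initial_set l y : closure (initial_set l) y -> e y <= \val l.
Proof.
move=> cly; rewrite leNgt; apply/negP => ly; have [eopen _] := ego.
have [|z [[c cl zc] lz]] := cly [set z | \val l < e z].
  by apply: open_nbhs_nbhs; split=> //; case: (eopen (\val l)).
by have := lt_le_trans (lz : \val l < e z) zc; rewrite lt_val ltNge (ltW cl).
Qed.

(** These are the limits at which [C] converges in [T]: a point of the closure outside the initial
    set lies above every [c < l]. *)
Definition initial_gaps := [set l : K | limit_of setT l /\ ~ closed (initial_set l)].

(** Choose such a closure point [phi l] at each level. A convex neighbourhood of [phi l] meets the
    initial set, hence contains [phi t] for all [t] of the set close below [l]. *)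
Lemma initial_gaps_not_stationary (x0 : T) : no_stationary_copy T ->
  regular_order K -> ~ stationary_set initial_gaps.
Proof.
move=> nostat Kreg Sst; have [_ econv] := ego.
have /choice[phi Hphi] : forall l, exists z, initial_gaps l ->
    closure (initial_set l) z /\ ~ initial_set l z.
  move=> l; have [[_ ncl]|ng] := pselect (initial_gaps l); last by exists x0.
  have [z /not_implyP[cz nz]] : exists z, ~ (closure (initial_set l) z -> initial_set l z).
    by apply/existsNP => h; apply: ncl.
  by exists z.
have phi_gt l c : initial_gaps l -> c < l -> \val c < e (phi l).
  move=> /Hphi[_ nz] cl; rewrite ltNge; apply/negP => zc.
  by apply: nz; exists c.
have phi_le l m : initial_gaps l -> initial_gaps m -> l <= m -> e (phi l) <= e (phi m).
  move=> gl gm lm; rewrite leNgt; apply/negP => ml.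
  have [eopen _] := ego; have [cl _] := Hphi _ gl.
  have [|z [[c cl' zc] /= mz]] := cl [set z | e (phi m) < e z].
    by apply: open_nbhs_nbhs; split=> //; case: (eopen (e (phi m))).
  have := lt_trans (phi_gt _ _ gm (lt_le_trans cl' lm)) mz.
  by rewrite ltNge zc.
apply: (nostat _ _ _ phi Kreg Sst).
  move=> l gl W Wl a al; have [cl _] := Hphi _ gl.
  have [V [Vl VW Vconv]] := econv _ _ Wl.
  have [p [[c cl' pc] Vp]] := cl _ Vl.
  exists c => // t gt ct tl; apply: VW; apply: (Vconv p (phi l)) => //.
  - exact: nbhs_singleton.
  - by apply: le_trans pc _; apply/ltW/phi_gt.
  - exact: phi_le.
(* In [E], [phi l] is sent to at most [l] and [phi m] strictly above [l]. *)
suff H l m : initial_gaps l -> initial_gaps m -> l < m -> phi l <> phi m.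
  move=> l m /[!inE] gl gm e12; have [//|lm] := eqVneq l m.
  by have /orP[/H|/H] := lt_total lm; [case/(_ gl gm)|case/(_ gm gl)].
move=> gl gm lm e12; have [cl _] := Hphi _ gl.
have := closure_initial_set cl; rewrite e12 leNgt => /negP; apply.
exact: phi_gt.
Qed.

(** If [N] has members below [l], their supremum [n] belongs to [N]. For [n < l] the block is an
    open set minus the closed initial set of [n]; for [n = l] it is empty. *)
Lemma initial_blocks_open N l : wf_order K -> limit_of N `<=` N -> N l ->
  (forall m, N m -> limit_of setT m /\ closed (initial_set m)) ->
  open [set y | initial_set l y /\ forall m, N m -> m < l -> ~ initial_set m y].
Proof.
move=> wf Nlim Nl Nclo.
have lo := initial_set_open (Nclo _ Nl).1.
have [[m0 [Nm0 m0l]]|nm] := pselect (exists m, N m /\ m < l); last first.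
  rewrite (_ : mkset _ = initial_set l)//; apply/seteqP; split=> [y []//|y ly].
  by split=> // m Nm ml; case: nm; exists m.
have [|n nub nmin] := wf [set n | forall m, N m -> m < l -> m <= n].
  by exists l => m _ /ltW.
have nl : n <= l by apply: nmin => m _ /ltW.
have nP m : m < n -> exists2 m', N m' & m < m' /\ m' < l.
  move=> mn; apply: contrapT => nm'; move: mn; rewrite ltNge => /negP; apply.
  apply: nmin => m' Nm' m'l; rewrite leNgt; apply/negP => mm'.
  by apply: nm'; exists m'.
have Nn : N n.
  have [Nn|nNn] := pselect (N n); first exact: Nn.
  apply: Nlim; split.
    exists m0; rewrite lt_neqAle nub// andbT.
    by apply/eqP => m0n; apply: nNn; rewrite -m0n.
  move=> a /nP[m Nm [am ml]]; exists m => //; rewrite am lt_neqAle nub// andbT.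
  by apply/eqP => mn; apply: nNn; rewrite -mn.
have [nl'|ln] := ltP n l.
  rewrite (_ : mkset _ = initial_set l `&` ~` initial_set n).
    by apply: openI => //; apply: closed_openC; exact: (Nclo _ Nn).2.
  apply/seteqP; split=> y [ly].
    by move=> /(_ n Nn nl').
  by move=> nny; split=> // m Nm ml my; apply/nny/(initial_set_le _ my)/nub.
rewrite (_ : mkset _ = set0); first exact: open0.
apply/seteqP; split=> // y [[c cl yc] ny].
have [m Nm [cm ml]] : exists2 m, N m & c < m /\ m < l.
  by apply: nP; apply: lt_le_trans ln.
by apply: (ny m) => //; exists c.
Qed.

End initial_sets.

End go_spaces.

(** * Refinements along one half of a class *)

Section convex_rays.
Local Open Scope order_scope.
Local Open Scope classical_set_scope.
Context {T : topologicalType} (U : set (set T)).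
Hypothesis nostat : no_stationary_copy T.
Local Notation good := (has_lf_refinement U).

Section ray.
Context {d : Order.disp_t} {E : orderType d} {e : T -> E}.
Hypothesis ego : go_embedding e.
Context (Q : set T) (x0 : T).
Hypotheses (Qo : open Q) (Qc : closed Q) (Qx0 : Q x0).
Let H := [set y | Q y /\ e x0 <= e y].
Hypothesis seg_good : forall y, H y -> good [set z | e x0 <= e z /\ e z <= e y].

Lemma nbhs_setC_clopen x : ~ Q x -> nbhs x (~` Q).
Proof. by move=> nQx; apply: open_nbhs_nbhs; split=> //; exact: closed_openC. Qed.

(** Without a maximum, [h] yields a strictly increasing cofinal sequence [c], and [H] is covered by
    open blocks bounded by its terms. *)
Lemma countable_ray_refinement (h : nat -> T) :
  (forall n, H (h n)) -> (forall y, H y -> exists n, e y <= e (h n)) -> good H.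
Proof.
move=> Hh hcof; have [eopen _] := ego.
have Hx0 : H x0 by split.
have [[m Hm mmax]|nmax] := pselect (exists2 m, H m & forall y, H y -> e y <= e m).
  by apply: has_lf_refinementS (seg_good Hm) => y Hy; split; [case: Hy|exact: mmax].
have /choice[nx Hnx] : forall yn : T * nat, exists z, H yn.1 ->
    [/\ H z, e yn.1 < e z & e (h yn.2) <= e z].
  case=> y n; have [Hy|nHy] := pselect (H y); last by exists y.
  have [z /not_implyP[Hz /negP]] : exists z, ~ (H z -> e z <= Order.max (e y) (e (h n))).
    apply/existsNP => hz; apply: nmax.
    exists (if e y <= e (h n) then h n else y); first by case: ifP.
    by move=> z /hz; case: (leP (e y) (e (h n))).
  rewrite -ltNge gt_max => /andP[yz hz].
  by exists z => _; split=> //; exact: ltW.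
pose fix c n := if n is n'.+1 then nx (c n', n') else x0.
have Hc n : H (c n) by elim: n => // n IH; case: (Hnx (c n, n) IH).
have clt n : e (c n) < e (c n.+1) by case: (Hnx (c n, n) (Hc n)).
have hc n : e (h n) <= e (c n.+1) by case: (Hnx (c n, n) (Hc n)).
have cmono : {homo (e \o c) : m n / (m <= n)%N >-> m <= n}.
  by apply: homo_leq => [//|? ? ?|n]; [exact: le_trans|exact/ltW/clt].
have ccof y : exists n, Q y -> e y < e (c n.+1).
  have [y0|y0] := ltP (e y) (e x0).
    by exists 0%N => _; exact: lt_trans (clt 0%N).
  have [Qy|nQy] := pselect (Q y); last by exists 0%N.
  have [n yn] := hcof y (conj Qy y0).
  by exists n.+1 => _; apply: le_lt_trans (le_trans yn (hc n)) (clt _).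
(* Block [n] reaches from [c (n - 1)] to [c (n + 1)], so that neighbouring blocks overlap and cover
   the terms of [c] too; block 0 has no lower end. *)
pose J n := Q `&` [set y | e y < e (c n.+1)] `&`
  (if n is m.+1 then [set y | e (c m) < e y] else setT).
apply: (@has_lf_refinement_bigcup _ _ _ setT J).
- move=> n _; apply: openI.
    by apply: openI => //; case: (eopen (e (c n.+1))).
  by case: n => [|n]; [exact: openT|case: (eopen (e (c n)))].
- move=> x; have [Qx|nQx] := pselect (Q x); last first.
    exists (~` Q); first exact: nbhs_setC_clopen.
    apply: sub_finite_set (finite_set0 _) => n [_ [y [[[Qy _] _] nQy]]].
    exact: nQy.
  have [N xN] := ccof x; exists [set y | e y < e (c N.+1)].
    by apply: open_nbhs_nbhs; split; [case: (eopen (e (c N.+1)))|exact: xN].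
  apply: sub_finite_set (finite_II N.+3) => -[|n] [_ [y [[_ /= ny] yN]]] //=.
  rewrite ltnNge; apply/negP => Nn.
  have := cmono N.+1 n (ltnW (Nn : (N.+1 < n)%N)); rewrite /= leNgt => /negP; apply.
  exact: lt_trans ny yN.
- move=> n _; apply: has_lf_refinementS (seg_good (Hc n.+1)).
  by move=> y [[[_ yc] _] [_ xy]]; split=> //; exact: ltW.
- move=> y [Qy xy]; have [n0 /(_ Qy) yn0] := ccof y.
  have ex : exists n, e y < e (c n.+1) by exists n0.
  case: (ex_minnP ex) => n yn nmin; exists n => //; split; first by split.
  case: n yn nmin => [//|n] yn nmin /=.
  apply: lt_le_trans (clt n) _; rewrite leNgt; apply/negP => /nmin.
  by rewrite ltnn.
Qed.

Lemma ray_refinement : good H.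
Proof.
have Hx0 : H x0 by split.
pose A := e @` H.
(* A sequence in [A] without strict upper bound in [A] is cofinal, which is the countable case. *)
have [Aom|] := pselect (forall h : nat -> E, (forall n, A (h n)) ->
    exists2 b, A b & forall n, h n < b); last first.
  move=> /existsNP[h /not_implyP[Ah hcof]].
  have /choice[g Hg] : forall n, exists y, H y /\ e y = h n.
    by move=> n; have [y Hy <-] := Ah n; exists y.
  apply: (@countable_ray_refinement g) => [n|y Hy]; first by case: (Hg n).
  apply: contrapT => /forallNP ny; apply: hcof; exists (e y); first by exists y.
  by move=> n; case: (Hg n) => _ <-; rewrite ltNge; apply/negP/ny.
have A0 : A !=set0 by exists (e x0), x0.
have [C [CA Ccof Kreg]] := regular_cofinal A0 Aom.
have [wf _ _] := Kreg.
have CP (l : set_type C) : exists2 y, H y & e y = \val l.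
  by have [y Hy yl] := CA _ (set_valP l); exists y.
have [N0 [N0lim N0cof N0gaps]] : exists N : set (set_type C), [/\
    limit_of N `<=` N, cofinal_set N & N `&` @initial_gaps T d E e C = set0].
  apply: contrapT => /forallNP nN.
  apply: (initial_gaps_not_stationary ego x0 nostat Kreg) => N Nlim Ncof.
  by apply/set0P/eqP => N0; apply: (nN N).
(* At limits the initial sets are open; outside [initial_gaps] they are closed as well. *)
pose N := N0 `&` limit_of setT.
have limW (l : set_type C) : limit_of N l -> limit_of N0 l /\ limit_of setT l.
  move=> [al lim]; split; split=> // a /lim[b [Nb _] ab]; by exists b.
have Nlim : limit_of N `<=` N by move=> l /limW[/N0lim].
(* A point closed under choosing larger members of [N0] is a limit of [N0], hence lies in [N]. *)
have Ngt (l : set_type C) : exists2 m, N m & l < m.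
  have /choice[nx Hnx] : forall c, exists m, N0 m /\ c < m.
    move=> c; have [c' cc'] := regular_order_gt Kreg c.
    by have [m Nm cm] := N0cof c'; exists m; split=> //; exact: lt_le_trans cm.
  have st : stationary_set [set: set_type C].
    by move=> M _ /(_ l)[m Mm _]; exists m.
  have [s _ sh] := stationary_set_closing Kreg
    (fun _ ts => if ts is t :: _ then nx t else l) st.
  have ls : l < s := sh 0%N [::] isT.
  have nxs a : a < s -> nx a < s.
    by move=> as_; apply: (sh 0%N [:: a]); rewrite /= as_.
  have s0 : limit_of N0 s.
    split=> [|a as_]; first by exists l.
    by exists (nx a); rewrite ?nxs ?andbT//; case: (Hnx a).
  exists s => //; split; first exact: N0lim.
  by case: s0 => al lim; split=> // a /lim[b _ ab]; exists b.
have Nclo m : N m -> limit_of setT m /\ closed (initial_set (e := e) m).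
  move=> [N0m ml]; split=> //; apply: contrapT => ncl.
  suff : set0 m by []; rewrite -N0gaps; split=> //; split.
(* [J l] collects the points whose first initial set along [N] is that of [l]; the blocks are
   pairwise disjoint and bounded by [l]. *)
pose J l := [set y | initial_set (e := e) l y /\
  forall m, N m -> m < l -> ~ initial_set (e := e) m y].
have Jo l : N l -> open (J l).
  by move=> Nl; exact: (initial_blocks_open ego wf Nlim Nl Nclo).
have Jcov y : Q y -> exists2 l, N l & J l y.
  move=> Qy; have [c yc] : exists c : set_type C, e y <= \val c.
    have [z Hz yz] : exists2 z, H z & e y <= e z.
      have [xy|/ltW yx] := leP (e x0) (e y); first by exists y.
      by exists x0.
    have [|c Cc zc] := Ccof (e z); first by exists z.
    by exists (exist _ c (mem_set Cc)); exact: le_trans zc.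
  have [l' Nl' cl'] := Ngt c.
  have [|l [Nl ly] lmin] := wf [set l | N l /\ initial_set (e := e) l y].
    by exists l'; split=> //; exists c.
  exists l => //; split=> // m Nm ml my; have := lmin m (conj Nm my).
  by rewrite leNgt ml.
apply: (@has_lf_refinement_bigcup _ _ _ N (fun l => J l `&` Q)).
- by move=> l Nl; apply: openI => //; exact: Jo.
- move=> x; have [Qx|nQx] := pselect (Q x); last first.
    exists (~` Q); first exact: nbhs_setC_clopen.
    apply: sub_finite_set (finite_set0 _) => n [_ [y [[_ Qy] nQy]]].
    exact: nQy.
  have [l Nl Jx] := Jcov x Qx; exists (J l).
    by apply: open_nbhs_nbhs; split=> //; exact: Jo.
  apply: sub_finite_set (finite_set1 l) => m [Nm [y [[[my nmy] _] [ly nly]]]].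
  have [//|/lt_total/orP[ml|lm]] := eqVneq m l.
    by case: (nly m).
  by case: (nmy l).
- move=> l Nl; have [t Ht tl] := CP l.
  apply: has_lf_refinementS (seg_good Ht) => y [[[[c cl yc] _] _] [_ xy]].
  split=> //; apply: le_trans yc _.
  by apply: ltW; rewrite tl lt_val.
- by move=> y [Qy _]; have [l Nl Jy] := Jcov y Qy; exists l.
Qed.
End ray.

End convex_rays.

(** * Paracompactness from the clopen classes *)

Section go_paracompact.
Local Open Scope order_scope.
Local Open Scope classical_set_scope.
Context {T : topologicalType} {d : Order.disp_t} {E : orderType d} {e : T -> E}.
Hypothesis ego : go_embedding e.

Lemma go_embedding_dual : go_embedding (e : T -> E^d).
Proof.
have [eopen econv] := ego; split=> [a|x W xW]; first by case: (eopen a).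
have [V [xV VW Vc]] := econv x W xW; exists V; split=> // a b c Va Vb ac cb.
exact: (Vc b a c).
Qed.

Hypothesis nostat : no_stationary_copy T.

Lemma go_space_refinement (U : set (set T)) : open_cover U ->
  has_lf_refinement U setT.
Proof.
move=> [Uo UT]; have [_ econv] := ego.
pose seg x y := [set z | e x <= e z /\ e z <= e y \/ e y <= e z /\ e z <= e x].
have segC x y : seg x y = seg y x by apply/seteqP; split=> z [|]; [right|left|right|left].
have segD x y z : seg x z `<=` seg x y `|` seg y z.
  move=> w; rewrite /seg /=.
  by case: (leP (e w) (e y)) => [|/ltW] wy [[]|[]]; auto.
pose Q x := [set y | has_lf_refinement U (seg x y)].
have Qsym x y : Q x y -> Q y x by rewrite /Q /= segC.
have Qtrans x y z : Q x y -> Q y z -> Q x z.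
  by move=> xy yz; apply: has_lf_refinementS (segD x y z) _; exact: has_lf_refinementU.
have Qnbhs y : nbhs y (Q y).
  have [u Uu uy] : (\bigcup_(u in U) u) y by rewrite UT.
  have [V [yV Vu Vc]] := econv y u (open_nbhs_nbhs (conj (Uo _ Uu) uy)).
  have Vy : V y by exact: nbhs_singleton yV.
  apply: filterS yV => z Vz; apply: (has_lf_refinement1 Uu (Uo _ Uu)).
  by move=> w [|] [? ?]; apply: Vu; [exact: (Vc y z)|exact: (Vc z y)].
have Qopen x : open (Q x).
  rewrite openE => y xy; apply: filterS (Qnbhs y) => z; exact: Qtrans.
have Qclosed x : closed (Q x).
  move=> y /(_ _ (Qnbhs y))[z [xz yz]]; exact: Qtrans xz (Qsym _ _ yz).
have Qrefl x : Q x x by exact: nbhs_singleton (Qnbhs x).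
have Qgood x : has_lf_refinement U (Q x).
  apply: has_lf_refinementS (_ : Q x `<=` [set y | Q x y /\ e x <= e y] `|`
      [set y | Q x y /\ e y <= e x]) _.
    by move=> y xy; case: (leP (e x) (e y)) => [|/ltW] h; [left|right].
  apply: has_lf_refinementU.
    apply: (ray_refinement nostat ego) => // y [xy _].
    by apply: has_lf_refinementS xy => z; left.
  apply: (ray_refinement nostat go_embedding_dual) => // y [xy _].
  by apply: has_lf_refinementS xy => z [zx yz]; right.
apply: (@has_lf_refinement_bigcup _ _ _ (range Q) id) => //.
- by move=> _ [x _ <-].
- move=> x; exists (Q x) => //.
  apply: sub_finite_set (finite_set1 (Q x)) => _ [[y _ <-] [z [yz xz]]].
  apply/seteqP; split=> w; first exact: Qtrans (Qtrans _ _ _ xz (Qsym _ _ yz)).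
  exact: Qtrans (Qtrans _ _ _ yz (Qsym _ _ xz)).
- by move=> _ [x _ <-]; rewrite setIT.
- by move=> x _; exists (Q x).
Qed.

Lemma go_space_paracompact : hausdorff_space T -> paracompact T.
Proof.
move=> hT; split=> // U Ucov.
have [V [Vo VU VT Vlf]] := go_space_refinement Ucov.
by exists V; split=> //; split=> //; exact/seteqP.
Qed.

End go_paracompact.

(** * Ordered spaces, their subspaces and the conclusion *)

Lemma go_embedding_order (d : Order.disp_t) (E : orderTopologicalType d) :
  go_embedding (@id E).
Proof.
split=> [a|x W]; first by rewrite -!set_itvE; split.
rewrite {1}itv_nbhsE => -[i [io xi] iW]; exists [set` i]; split=> //.
  by apply: open_nbhs_nbhs; split=> //; exact: itv_open_ends_open.
case: i {io xi iW} => l r a b c /=; rewrite !itv_boundlr.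
move=> /andP[la _] /andP[_ br] ac cb; apply/andP; split.
  by apply: le_trans la _; rewrite bnd_simp.
by apply: le_trans br; rewrite bnd_simp.
Qed.

Lemma go_embedding_set_type (T : topologicalType) (A : set T) (d : Order.disp_t)
    (E : orderType d) (e : T -> E) :
  go_embedding e -> go_embedding (e \o (set_val : set_type A -> T)).
Proof.
have vc : continuous (set_val : set_type A -> T) by exact: initial_continuous.
move=> [eopen econv]; split=> [a|x W xW].
  have [h1 h2] := eopen a; split.
    by apply: (open_comp _ h1) => ? _; exact: vc.
  by apply: (open_comp _ h2) => ? _; exact: vc.
have [V xV VW] := nbhs_set_type xW.
have [V' [xV' V'V V'c]] := econv _ _ xV.
exists (set_val @^-1` V'); split; first exact: vc.
  by move=> y /V'V /VW.
by move=> a b c; exact: V'c.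
Qed.

Lemma hausdorff_set_type (T : topologicalType) (A : set T) :
  hausdorff_space T -> hausdorff_space (set_type A).
Proof.
move=> hT x y xy; apply: val_inj; apply: hT => V W xV yW.
have vc : continuous (set_val : set_type A -> T) by exact: initial_continuous.
have [z [Vz Wz]] := xy _ _ (vc _ _ xV) (vc _ _ yW).
by exists (set_val z).
Qed.

Theorem theorem2p4 (R : realType) (d : Order.disp_t) (M : orderTopologicalType d) (L : set M)
    (X : topologicalType) (hX : lindelof_sigma R X)
    (hinj : exists F : set_type (Cp (set_type L) bool) -> set_type (Cp X R),
      continuous F /\ injective F) :
  (forall (d' : Order.disp_t) (kappa : orderTopologicalType d')
      (S : set kappa),
      uncountable_regular_ordinal kappa -> stationary S ->
      ~ exists D : set (set_type (dremainder L)),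
          homeomorphic (set_type D) (set_type S)) /\
  hereditarily_paracompact (set_type (dremainder L)).
Proof.
have [Y [N [C [G [NC Ginj Gc1 Gc2]]]]] := dremainder_separate_family hX hinj.
split=> [d' kappa S kord Sst [D]|D].
  exact: (stationary_not_embeddable NC Ginj Gc1 Gc2 kord Sst).
have vc : continuous (set_val : set_type D -> set_type (dremainder L)).
  exact: initial_continuous.
(* The order comes from the completion in two steps: to the remainder, then to [D]. *)
have ego := go_embedding_set_type D
  (go_embedding_set_type (dremainder L) (@go_embedding_order _ (dcompletion L))).
apply: (go_space_paracompact ego); last first.
  exact/hausdorff_set_type/hausdorff_set_type/order_hausdorff.
move=> d' K S phi Kreg Sst phic.
(* Restricted to [D], the family [G] stays injective and separately continuous. *)
apply: (stationary_sigma_not_injective NC (G := G \o set_val)) => //.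
- by move=> r s /Ginj/val_inj.
- by move=> r; exact: Gc1.
- by move=> y r; exact: (cvg_comp _ _ (vc r) (Gc2 y _)).
Qed.
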